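(* Let $n$ and $m$ be positive integers. Let $\mathbf{c}\in\mathbb{Z}[t]^n$, $A\in\mathbb{Z}[t]^{m\times n}$ and $\mathbf{b}\in\mathbb{Z}[t]^m$. For every positive integer $t$, let $R(t):=\{\mathbf{x}\in\mathbb{R}^n \mid \mathbf{x}\ge\mathbf{0} \wedge A(t)\mathbf{x}=\mathbf{b}(t)\}$ and $L(t):=R(t)\cap\mathbb{Z}^n$. Assume that $R(t)$ is bounded for all positive integers $t$. For all positive integers $\ell$, let $f_\ell(t)$ be the $\ell^{\text{th}}$ largest value (with multiplicity) of $\mathbf{c}^{\intercal}(t)\mathbf{x}$ for $\mathbf{x}\in L(t)$, or $-\infty$ if $|L(t)|<\ell$. Then for all positive integers $\ell$, $f_\ell$ is eventually quasi-polynomial.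
   Context: Inequalities between vectors are coordinate-wise. The variables $t$ and $\ell$ range over positive integers. The $\ell^{\text{th}}$ largest value with multiplicity means the $\ell^{\text{th}}$ largest element of the multiset $\{\mathbf{c}^{\intercal}(t)\mathbf{x} : \mathbf{x}\in L(t)\}$ (one entry for each $\mathbf{x}\in L(t)$). A function $g$ is eventually quasi-polynomial if its domain is a subset of $\mathbb{Z}$ containing all sufficiently large integers and there exist a positive integer $d$ and polynomials $P_0,\ldots,P_{d-1}\in\mathbb{R}[t]$ such that for all sufficiently large $t$, $g(t)=P_{t \bmod d}(t)$. By convention the constant function $-\infty$ counts as a polynomial, so each $P_j$ is allowed to be the constant $-\infty$. *)

(* Defs.v *)
From HB Require Import structures.
From mathcomp Require Import all_boot all_order all_algebra.
From mathcomp Require Import finmap.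
From mathcomp Require Import all_classical all_reals all_analysis.
Set Implicit Arguments.
Unset Strict Implicit.
Unset Printing Implicit Defensive.
Import Order.TTheory GRing.Theory Num.Theory.
Import numFieldNormedType.Exports.
Local Open Scope classical_set_scope.
Local Open Scope ring_scope.

Definition eval_mx (p q : nat) (M : 'M[{poly int}]_(p, q)) (t : int) :
  'M[int]_(p, q) := map_mx (fun P : {poly int} => P.[t]) M.

Definition real_points (R : realType) (m n : nat) (A : 'M[{poly int}]_(m, n))
    (b : 'cV[{poly int}]_m) (t : int) : set 'cV[R]_n :=
  [set x : 'cV[R]_n | (forall i, 0 <= x i 0) /\
           map_mx intr (eval_mx A t) *m x = map_mx intr (eval_mx b t)].
Arguments real_points R {m n} A b t.

Definition integer_points (R : realType) (m n : nat)
    (A : 'M[{poly int}]_(m, n)) (b : 'cV[{poly int}]_m) (t : int) :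
    set 'cV[int]_n :=
  [set z : 'cV[int]_n | real_points R A b t (map_mx intr z)].

(* [fset_set] enumerates each point of a finite set exactly once, so equal
   objective values at different points are repeated.  It is empty on an
   infinite set: the list is meaningful only when there are finitely many
   integer points, which holds when [real_points R A b t] is bounded. *)
Definition sorted_values (R : realType) (m n : nat) (c : 'cV[{poly int}]_n)
    (A : 'M[{poly int}]_(m, n)) (b : 'cV[{poly int}]_m) (t : int) : seq int :=
  sort >=%R [seq ((eval_mx c t)^T *m z) 0 0
            | z <- enum_fset (fset_set (integer_points R A b t))].

(* Positions are counted from 1: [l = 1] gives the maximum.  The default value
   of [nth] applies when there are fewer than [l] integer points. *)
Definition lth_largest (R : realType) (m n : nat) (c : 'cV[{poly int}]_n)
    (A : 'M[{poly int}]_(m, n)) (b : 'cV[{poly int}]_m) (l : nat) (t : int) :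
    \bar R :=
  nth -oo%E [seq (v%:~R)%:E | v <- sorted_values R c A b t] l.-1.
Arguments lth_largest R {m n} c A b l t.

(* [None] stands for the constant [-oo], which counts as a polynomial. *)
Definition poly_or_ninfty_eval (R : realType) (P : option {poly R}) (x : R) :
    \bar R :=
  if P is Some p then (p.[x])%:E else -oo%E.

(* The function is [g] restricted to its domain [D]; the values of [g]
   outside [D] are irrelevant. *)
Definition eventually_quasi_polynomial (R : realType) (D : set int)
    (g : int -> \bar R) : Prop :=
  exists d : nat, (0 < d)%N /\
  exists P : 'I_d -> option {poly R},
  exists N : int, forall t : int, N <= t ->
    D t /\
    forall j : 'I_d, (t %% d)%Z = j ->
      g t = poly_or_ninfty_eval (P j) t%:~R.

(* Main.v *)
(* For large [t] every integer point lies in a box [0 <= x j < t ^ r]: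
   Fourier-Motzkin elimination produces inequalities with coefficients bounded
   by powers of [t], so a coordinate is either unbounded or at most a fixed
   power of [t].  Write the coordinates, together with the shifted objective
   value, in base [t].  Once the carries, which take finitely many values, are
   fixed, the equations become linear in the digits and in [t] with constant
   coefficients.  So the encoded points form a Presburger-definable family in
   which all variables but [t] are bounded, and with the digits of the
   objective placed first the order of the values is refined by the
   lexicographic order of the digits.  Quantifier elimination shows that the
   lexicographically largest point is again Presburger-definable, hence so is
   the [l]-th largest, and that its digits are, on each residue class of [t],
   eventually affine in [t].  The objective value is then a polynomial in [t]. *)

Require Import Defs.
From mathcomp Require Import all_boot all_order all_algebra.
From mathcomp Require Import finmap.
From mathcomp Require Import all_classical all_reals all_analysis.
From mathcomp Require Import zify ring lra.
Import Order.TTheory GRing.Theory Num.Theory.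
Import numFieldNormedType.Exports.
Set Implicit Arguments.
Unset Strict Implicit.
Unset Printing Implicit Defensive.
Local Open Scope classical_set_scope.
Local Open Scope ring_scope.

(** * Presburger predicates over a parameter and bounded variables *)

(* Variable [0] is the parameter [t], the others are the digits. *)
Definition env := nat -> int.

Definition upd (T : Type) (e : nat -> T) (n : nat) (v : T) : nat -> T :=
  fun i => if i == n then v else e i.

Lemma upd_eq (T : Type) (e : nat -> T) n v : upd e n v n = v.
Proof. by rewrite /upd eqxx. Qed.

Lemma upd_neq (T : Type) (e : nat -> T) n v i : i != n -> upd e n v i = e i.
Proof. by rewrite /upd => /negPf->. Qed.

Lemma upd_upd (T : Type) (e : nat -> T) n v w : upd (upd e n v) n w = upd e n w.
Proof. by apply/funext => i; rewrite /upd; case: eqP. Qed.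

Lemma upd_id (T : Type) (e : nat -> T) n : upd e n (e n) = e.
Proof. by apply/funext => i; rewrite /upd; case: eqP => // ->. Qed.

(** The coefficients are constants and the parameter is variable [0], so [t] may occur linearly but
    never multiplied by a digit. *)
Definition lin (n : nat) (f : env -> int) : Prop :=
  exists (c : int) (a : nat -> int), forall e, f e = c + \sum_(i < n) a i * e i.

Lemma lin_cst n c : lin n (fun=> c).
Proof.
exists c, (fun=> 0) => e; rewrite big1 ?addr0// => i _.
by rewrite mul0r.
Qed.

Lemma lin_var n i : (i < n)%N -> lin n (fun e => e i).
Proof.
move=> ltin; exists 0, (fun k => (k == i)%:R) => e.
rewrite add0r (bigD1 (Ordinal ltin))//= eqxx mul1r big1 ?addr0// => j.
by rewrite -val_eqE /= => /negPf->; rewrite mul0r.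
Qed.

Lemma linD n f g : lin n f -> lin n g -> lin n (fun e => f e + g e).
Proof.
move=> [c [a fE]] [d [b gE]]; exists (c + d), (fun i => a i + b i) => e.
rewrite fE gE addrACA; congr (_ + _).
by rewrite -big_split; apply: eq_bigr => i _ /=; rewrite mulrDl.
Qed.

Lemma linZ n k f : lin n f -> lin n (fun e => k * f e).
Proof.
move=> [c [a fE]]; exists (k * c), (fun i => k * a i) => e.
by rewrite fE mulrDr mulr_sumr; congr (_ + _); apply: eq_bigr => i _; rewrite mulrA.
Qed.

Lemma lin_recr n f : lin n.+1 f ->
  exists a g, lin n g /\ forall e, f e = g e + a * e n.
Proof.
move=> [c [a fE]]; exists (a n), (fun e => c + \sum_(i < n) a i * e i).
by split=> [|e]; [exists c, a | rewrite fE big_ord_recr /= addrA].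
Qed.

Lemma lin_local n f e e' : lin n f -> (forall i, (i < n)%N -> e i = e' i) ->
  f e = f e'.
Proof.
move=> [c [a fE]] ee'; rewrite !fE; congr (_ + _).
by apply: eq_bigr => i _; rewrite ee'.
Qed.

Lemma lin_upd n f e v : lin n f -> f (upd e n v) = f e.
Proof.
by move=> /lin_local; apply => i ltin; rewrite upd_neq// neq_ltn ltin.
Qed.

(** Quantifier-free Presburger formulas, given by their truth functions instead of syntax; [qf_ext]
    lets a formula be replaced by an equivalent one. *)
Inductive qf (n : nat) : (env -> bool) -> Prop :=
| qf_ge0 f : lin n f -> qf n (fun e => 0 <= f e)
| qf_dvd d f : 0 < d -> lin n f -> qf n (fun e => (d %| f e)%Z)
| qf_and P Q : qf n P -> qf n Q -> qf n (fun e => P e && Q e)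
| qf_not P : qf n P -> qf n (fun e => ~~ P e)
| qf_ext P Q : qf n P -> P =1 Q -> qf n Q.

Lemma qf_or n P Q : qf n P -> qf n Q -> qf n (fun e => P e || Q e).
Proof.
move=> qP qQ; apply: qf_ext (qf_not (qf_and (qf_not qP) (qf_not qQ))) _ => e.
by rewrite negb_and !negbK.
Qed.

Lemma qf_le n f g : lin n f -> lin n g -> qf n (fun e => f e <= g e).
Proof.
move=> lf lg; apply: qf_ext (qf_ge0 (linD lg (linZ (-1) lf))) _ => e.
by rewrite mulN1r subr_ge0.
Qed.

Lemma qf_eq n f g : lin n f -> lin n g -> qf n (fun e => f e == g e).
Proof.
move=> lf lg; apply: qf_ext (qf_and (qf_le lf lg) (qf_le lg lf)) _ => e.
by rewrite -eq_le.
Qed.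

Lemma qf_true n : qf n xpredT.
Proof. by apply: qf_ext (qf_ge0 (lin_cst n 0)) _ => e; rewrite lexx. Qed.

Lemma qf_all n (T : eqType) (s : seq T) (F : T -> env -> bool) :
  {in s, forall x, qf n (F x)} -> qf n (fun e => all (F^~ e) s).
Proof.
elim: s => [_|x s IHs Fs] /=; first exact: qf_true.
apply: qf_and; first by apply: Fs; rewrite mem_head.
by apply: IHs => y ys; apply: Fs; rewrite inE ys orbT.
Qed.

Lemma qf_has n (T : eqType) (s : seq T) (F : T -> env -> bool) :
  {in s, forall x, qf n (F x)} -> qf n (fun e => has (F^~ e) s).
Proof.
move=> Fs; have /qf_not qs : qf n (fun e => all (fun x => ~~ F x e) s).
  by apply: (@qf_all n _ s (fun x e => ~~ F x e)) => x /Fs; apply: qf_not.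
by apply: qf_ext qs _ => e; rewrite -has_predC; apply: eq_has => x /=; rewrite negbK.
Qed.

Lemma qf_local n P e e' : qf n P -> (forall i, (i < n)%N -> e i = e' i) ->
  P e = P e'.
Proof.
move=> qP ee'; elim: qP => {P} [f lf|d f _ lf|P Q _ -> _ ->|P _ ->|P Q _ + PQ]//.
- by rewrite (lin_local lf ee').
- by rewrite (lin_local lf ee').
- by rewrite !PQ.
Qed.

Lemma lin_widen n f : lin n f -> lin n.+1 f.
Proof.
move=> [c [a fE]]; exists c, (fun i => if (i < n)%N then a i else 0) => e.
rewrite big_ord_recr /= ltnn mul0r addr0 fE; congr (_ + _).
by apply: eq_bigr => i _; rewrite ltn_ord.
Qed.

Lemma qf_widen n P : qf n P -> qf n.+1 P.
Proof.
elim=> {P}.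
- by move=> f /lin_widen; apply: qf_ge0.
- by move=> d f d_gt0 /lin_widen; apply: qf_dvd.
- by move=> P Q _ qP _ qQ; apply: qf_and.
- by move=> P _ qP; apply: qf_not.
- by move=> P Q _ qP; apply: qf_ext.
Qed.

(* [p.1 * v = p.2 e] describes a value [v] of the last variable as a rational
   affine function of the others. *)
Definition cand := (int * (env -> int))%type.
Definition good_cand n (p : cand) := 0 < p.1 /\ lin n p.2.

Lemma mem_cand_range (b : int) (f : env -> int) (m : nat) (v : int) e :
  0 <= f e - b * v <= m%:Z ->
  exists2 p : cand, p \in [seq ((b, fun e => f e - k%:Z) : cand) | k <- iota 0 m.+1]
    & p.1 * v = p.2 e.
Proof.
case/andP=> f_ge f_le; exists ((b, fun e' => f e' - (absz (f e - b * v)%R)%:Z) : cand).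
  by apply/mapP; exists (absz (f e - b * v)%R) => //; rewrite mem_iota; lia.
by rewrite /= gez0_abs//; ring.
Qed.

(* A shift by a common multiple [D] of all moduli can change the truth value
   only by crossing a root of one of the inequalities. *)
Lemma qf_switch n P : qf n.+1 P -> exists D0 : int, 0 < D0 /\
  forall D : int, 0 < D -> (D0 %| D)%Z -> exists s : seq cand,
    {in s, forall p, good_cand n p} /\
    forall e, P e != P (upd e n (e n + D)) ->
      exists2 p : cand, p \in s & p.1 * e n = p.2 e.
Proof.
elim=> {P}.
- move=> f /lin_recr[a [g [lg fE]]]; exists 1; split=> // D D_gt0 _.
  case: (ltrgtP a 0) => a0.
  + have aD : 0 <= - a * D by nia.
    (* For [a < 0] the shift lowers [g e + a * e n] by [- a * D]; if the sign changes, the value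
       before the shift lies between [0] and [- a * D], and the candidates list these integers. The
       case [0 < a] is the mirror image. *)
    exists [seq (- a, fun e => g e - k%:Z) | k <- iota 0 (absz (- a * D)%R).+1].
    split.
      move=> p /mapP[k _ ->]; split=> /=; first by lia.
      by apply: linD => //; apply: lin_cst.
    move=> e; rewrite !fE upd_eq (lin_upd _ _ lg) => neq.
    by apply: mem_cand_range; rewrite gez0_abs//; nia.
  + have aD : 0 <= a * D by nia.
    exists [seq (a, fun e => - g e - k%:Z) | k <- iota 0 (absz (a * D)%R).+1].
    split.
      move=> p /mapP[k _ ->]; split=> //=.
      apply: linD => //; last exact: lin_cst.
      have [c [b h]] := linZ (-1) lg.
      by exists c, b => e; rewrite -h mulN1r.
    move=> e; rewrite !fE upd_eq (lin_upd _ _ lg) => neq.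
    by apply: (@mem_cand_range a (fun e => - g e)); rewrite gez0_abs//; nia.
  + by exists [::]; split=> // e; rewrite !fE a0 !mul0r !addr0 (lin_upd _ _ lg) eqxx.
- move=> d f d_gt0 /lin_recr[a [g [lg fE]]]; exists d; split=> // D D_gt0 dD.
  exists [::]; split=> // e.
  rewrite !fE upd_eq (lin_upd _ _ lg) mulrDr addrA [X in _ != X]rpredDr ?eqxx//.
  exact: dvdz_mull.
- move=> P Q _ [D1 [D1_gt0 IHP]] _ [D2 [D2_gt0 IHQ]].
  exists (D1 * D2); split=> [|D D_gt0 dvdD]; first exact: mulr_gt0.
  have [|s [gs IHs]] := IHP D D_gt0; first by apply: dvdz_trans dvdD; apply: dvdz_mulr.
  have [|s' [gs' IHs']] := IHQ D D_gt0; first by apply: dvdz_trans dvdD; apply: dvdz_mull.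
  exists (s ++ s'); split=> [p|e neq].
    by rewrite mem_cat => /orP[/gs|/gs'].
  have [/IHs[p ps pe]|samP] := boolP (P e != P (upd e n (e n + D))).
    by exists p => //; rewrite mem_cat ps.
  have [/IHs'[p ps pe]|samQ] := boolP (Q e != Q (upd e n (e n + D))).
    by exists p => //; rewrite mem_cat ps orbT.
  by move: neq; rewrite (eqP (negbNE samP)) (eqP (negbNE samQ)) eqxx.
- move=> P _ [D0 [D0_gt0 IHP]]; exists D0; split=> // D D_gt0 dvdD.
  have [s [gs IHs]] := IHP D D_gt0 dvdD; exists s; split=> // e neq.
  by apply: IHs; apply: contra neq => /eqP->.
- move=> P Q _ [D0 [D0_gt0 IHP]] PQ; exists D0; split=> // D D_gt0 dvdD.
  have [s [gs IHs]] := IHP D D_gt0 dvdD; exists s; split=> // e.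
  by rewrite -!PQ; apply: IHs.
Qed.

Definition subst_cand n (P : env -> bool) (p : cand) (e : env) : bool :=
  (p.1 %| p.2 e)%Z && P (upd e n (p.2 e %/ p.1)%Z).

Lemma subst_candP n (P : env -> bool) (p : cand) e : 0 < p.1 ->
  reflect (exists2 v, p.1 * v = p.2 e & P (upd e n v)) (subst_cand n P p e).
Proof.
move=> p_gt0; apply: (iffP andP) => [[/divzK dvd Pe]|[v pv Pe]].
  by eexists; last exact: Pe; rewrite mulrC.
by rewrite -pv mulKz ?gt_eqF// dvdz_mulr.
Qed.

(** Scaling every inequality and divisibility by the positive [p.1] lets [p.1 * v] be replaced by
    [p.2 e], so no division remains inside [P]. *)
Lemma qf_subst n P p : good_cand n p -> qf n.+1 P -> qf n (subst_cand n P p).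
Proof.
case: p => b f [/= b_gt0 lf] qP.
suff [Q qQ QP] : exists2 Q, qf n Q & forall e v, b * v = f e -> Q e = P (upd e n v).
  apply: qf_ext (qf_and (qf_dvd b_gt0 lf) qQ) _ => e /=.
  rewrite /subst_cand /=; case: (boolP (_ %| _)%Z) => //= /divzK dvd.
  by apply: QP; rewrite mulrC.
elim: qP => {P}.
- move=> g /lin_recr[a [h [lh gE]]].
  exists (fun e => 0 <= b * h e + a * f e); first exact: qf_ge0 (linD (linZ _ lh) (linZ _ lf)).
  move=> e v <-; rewrite gE upd_eq (lin_upd _ _ lh) mulrCA -mulrDr.
  by rewrite pmulr_rge0.
- move=> d g d_gt0 /lin_recr[a [h [lh gE]]].
  exists (fun e => (b * d %| b * h e + a * f e)%Z).
    by apply: qf_dvd (linD (linZ _ lh) (linZ _ lf)); apply: mulr_gt0.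
  move=> e v <-; rewrite gE upd_eq (lin_upd _ _ lh) mulrCA -mulrDr.
  by rewrite dvdz_mul2l// gt_eqF.
- move=> P1 P2 _ [Q1 q1 QP1] _ [Q2 q2 QP2].
  exists (fun e => Q1 e && Q2 e); first exact: qf_and.
  by move=> e v bv; rewrite (QP1 _ _ bv) (QP2 _ _ bv).
- move=> P1 _ [Q1 q1 QP1]; exists (fun e => ~~ Q1 e); first exact: qf_not.
  by move=> e v bv; rewrite (QP1 _ _ bv).
- move=> P1 P2 _ [Q1 q1 QP1] P12; exists Q1 => // e v bv.
  by rewrite (QP1 _ _ bv) P12.
Qed.

Lemma int_max (p : pred int) (v0 M : int) : p v0 -> (forall v, p v -> v <= M) ->
  exists2 v, p v & forall w, p w -> w <= v.
Proof.
move=> pv0 pM; move: {2}(absz (M - v0)%R) (leqnn (absz (M - v0)%R)) => k.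
elim: k v0 pv0 => [|k IHk] v0 pv0 lek.
  by exists v0 => // w /pM; have := pM _ pv0; lia.
have [[w [pw ltw]]|nw] := pselect (exists w, p w /\ v0 < w).
  by apply: (IHk w pw); have := pM _ pw; lia.
by exists v0 => // w pw; rewrite leNgt; apply/negP => ltw; apply: nw; exists w.
Qed.

Definition boxed (n : nat) (e : env) : bool :=
  all (fun i => (0 <= e i) && (e i < e 0%N)) (iota 1 n).

Lemma boxedP n e :
  reflect (forall i, (0 < i <= n)%N -> 0 <= e i < e 0%N) (boxed n e).
Proof.
apply: (iffP allP) => h i; last by rewrite mem_iota add1n ltnS; apply: h.
by move=> hi; apply: h; rewrite mem_iota add1n ltnS.
Qed.

Lemma qf_elim n P : qf n.+2 P -> (forall e, P e -> boxed n.+1 e) ->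
  exists s : seq cand, {in s, forall p, good_cand n.+1 p} /\
  forall e, P e -> exists v, [/\ P (upd e n.+1 v),
    forall w, P (upd e n.+1 w) -> w <= v &
    exists2 p : cand, p \in s & p.1 * v = p.2 e].
Proof.
move=> qP bP; have [D [D_gt0 /(_ D D_gt0 (dvdzz D))[s [gs sP]]]] := qf_switch qP.
exists s; split=> // e Pe.
have [||v Pv vmax] := @int_max (fun v => P (upd e n.+1 v)) (e n.+1) (e 0%N).
- by rewrite upd_id.
- by move=> v /bP/boxedP/(_ n.+1); rewrite upd_eq upd_neq// ltnSn => /(_ isT)/andP[_ /ltW].
exists v; split=> //.
have [|p ps pe] := sP (upd e n.+1 v).
  rewrite Pv upd_eq upd_upd; apply/negP => /eqP/esym/vmax; lia.
by exists p => //; rewrite upd_eq (lin_upd _ _ (gs _ ps).2) in pe.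
Qed.

(** * Base [t] expansions and lexicographic maxima *)

Fixpoint base_val (t : int) (f : nat -> int) (r : nat) : int :=
  if r is q.+1 then base_val t f q * t + f q else 0.

(** The digit [f 0] is the most significant one. If a prefix of [f] had the larger value, it would
    exceed that of [g] by at least one, which the next digit, being below [t], cannot make up. *)
Lemma base_val_prefix t f g r q : (forall k, (k < r)%N -> 0 <= f k < t) ->
  (forall k, (k < r)%N -> 0 <= g k < t) ->
  base_val t f r <= base_val t g r -> (q <= r)%N ->
  base_val t f q <= base_val t g q.
Proof.
elim: r => [|r IHr] fb gb /= le_fg; first by rewrite leqn0 => /eqP->.
rewrite leq_eqVlt => /orP[/eqP->//|]; rewrite ltnS.
apply: IHr => [k ltk|k ltk|]; [exact/fb/ltnW|exact/gb/ltnW|].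
have := fb r (ltnSn r); have := gb r (ltnSn r); nia.
Qed.

Lemma base_val_inj t f g r : (forall k, (k < r)%N -> 0 <= f k < t) ->
  (forall k, (k < r)%N -> 0 <= g k < t) ->
  base_val t f r = base_val t g r -> forall k, (k < r)%N -> f k = g k.
Proof.
move=> fb gb fg k ltkr.
have pre q : (q <= r)%N -> base_val t f q = base_val t g q.
  move=> leqr; apply/eqP; rewrite eq_le.
  by apply/andP; split; apply: (base_val_prefix _ _ _ leqr); rewrite ?fg.
by have := pre _ ltkr; rewrite /= (pre k (ltnW ltkr)); lia.
Qed.

Lemma eq_base_val t f g r : (forall k, (k < r)%N -> f k = g k) ->
  base_val t f r = base_val t g r.
Proof.
elim: r => //= r IHr fg; rewrite fg// IHr// => k ltkr.
exact/fg/ltnW.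
Qed.

Lemma base_val_ge0 t f r : (forall k, (k < r)%N -> 0 <= f k < t) ->
  0 <= base_val t f r.
Proof.
elim: r => //= r IHr fb; have := fb r (ltnSn r).
have : 0 <= base_val t f r by apply: IHr => k ltkr; exact/fb/ltnW.
nia.
Qed.

Lemma base_val_exists t r (X : int) : 0 < t -> 0 <= X < t ^+ r ->
  exists f, (forall k, (k < r)%N -> 0 <= f k < t) /\ base_val t f r = X.
Proof.
move=> t_gt0; elim: r X => [|r IHr] X Xb.
  by exists (fun=> 0); split => //=; rewrite expr0 in Xb; lia.
have [|f [fb fX]] := IHr (X %/ t)%Z.
  rewrite divz_ge0//; apply/andP; split; first by case/andP: Xb.
  by rewrite ltz_divLR// -exprSr; case/andP: Xb.
exists (fun k => if (k < r)%N then f k else (X %% t)%Z); split.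
  move=> k _; case: ifP => [/fb//|_].
  by rewrite modz_ge0 ?gt_eqF//= ltz_pmod.
rewrite /= ltnn [RHS](divz_eq X t) -fX; congr (_ * _ + _).
by apply: eq_base_val => k ->.
Qed.

Definition digit (e : env) : nat -> int := fun k => e k.+1.

Lemma boxed_digit m e : boxed m e ->
  forall k, (k < m)%N -> 0 <= digit e k < e 0%N.
Proof. by move=> /boxedP be k ltkm; apply: be. Qed.

(* On digit vectors, comparing the encoded integers [base_val] is the
   lexicographic order, so the digits can be maximised one after another. *)
Lemma qf_max m P : qf m.+1 P -> (forall e, P e -> boxed m e) ->
  exists Q, [/\ qf m.+1 Q, forall e, Q e -> P e,
    forall e e', Q e -> P e' -> e' 0%N = e 0%N ->
      base_val (e 0%N) (digit e') m <= base_val (e 0%N) (digit e) m &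
    forall e, P e -> exists2 e', Q e' & e' 0%N = e 0%N].
Proof.
elim: m P => [|m IHm] P qP bP.
  by exists P; split=> // e Pe; exists e.
have [s [gs sP]] := qf_elim qP bP.
pose P' e := has (fun p => subst_cand m.+1 P p e) s.
have P'P e : P' e -> exists v, P (upd e m.+1 v).
  case/hasP => p /gs[p_gt0 _] /(subst_candP _ _ _ p_gt0)[v _ Pv].
  by exists v.
have PP' e v : P (upd e m.+1 v) -> P' e.
  move=> /sP[w []]; rewrite upd_upd => Pw _ [p ps pw].
  have [p_gt0 lp] := gs p ps; rewrite lin_upd// in pw.
  by apply/hasP; exists p => //; apply/subst_candP => //; exists w.
have qP' : qf m.+1 P'.
  by apply: (@qf_has _ _ _ (subst_cand m.+1 P)) => p /gs gp; apply: qf_subst.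
have bP' e : P' e -> boxed m e.
  case/P'P=> v /bP/boxedP be; apply/boxedP => i /andP[i_gt0 leim].
  by have := be i; rewrite !upd_neq ?neq_ltn ?ltnS ?leim// i_gt0 ltnW// => ->.
have [Q' [qQ' Q'P' Q'max Q'ex]] := IHm P' qP' bP'.
(* Quantifier-free form of maximality: the largest admissible last digit is itself a candidate, so
   comparing with the candidates suffices. *)
pose last_max e := all (fun p => ~~ subst_cand m.+1 P p e || (p.2 e <= p.1 * e m.+1)) s.
have last_maxP e : last_max e -> forall v, P (upd e m.+1 v) -> v <= e m.+1.
  move=> /allP maxe v Pv; have [w [Pw maxw [p ps pw]]] := sP _ Pv.
  have [p_gt0 lp] := gs p ps; rewrite lin_upd// in pw; rewrite upd_upd in Pw.
  have /orP[/negP[]|] := maxe p ps; first by apply/subst_candP => //; exists w.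
  by rewrite -pw ler_pM2l//; apply: le_trans; apply: maxw; rewrite upd_upd.
exists (fun e => P e && (Q' e && last_max e)); split.
- apply: qf_and => //; apply: qf_and; first exact: qf_widen.
  apply: (@qf_all _ _ _ (fun p e => ~~ subst_cand m.+1 P p e || (p.2 e <= p.1 * e m.+1))).
  move=> p ps; have [p_gt0 lp] := gs p ps.
  apply: qf_or; first by apply/qf_not/qf_widen/qf_subst.
  by apply: qf_le; [exact: lin_widen|exact/linZ/lin_var].
- by move=> e /andP[].
- move=> e e' /and3P[Pe Q'e maxe] Pe' e'0.
  have be' := boxed_digit (bP _ Pe'); have be := boxed_digit (bP _ Pe).
  have P'e' : P' e' by apply: (PP' _ (e' m.+1)); rewrite upd_id.
  have le_ee' := Q'max e e' Q'e P'e' e'0.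
  have := be' m (ltnSn m); have := be m (ltnSn m); rewrite e'0 /=.
  (* A strict inequality between the leading parts cannot be reversed by the last digit. Otherwise
     the leading digits agree, and [last_max] compares the last ones. *)
  move: le_ee'; rewrite le_eqVlt => /orP[/eqP eq_ee'|]; last by nia.
  have eq_dig k : (k < m)%N -> digit e' k = digit e k.
    apply: (base_val_inj _ _ eq_ee') => i ltim; last exact/be/ltnW.
    by rewrite -e'0; exact/be'/ltnW.
  have : e' m.+1 <= e m.+1.
    apply: last_maxP => //; rewrite (qf_local (e' := e') qP)// => -[|i]; first by rewrite upd_neq.
    rewrite !ltnS leq_eqVlt => /orP[/eqP->|ltim]; first by rewrite upd_eq.
    by rewrite upd_neq ?neq_ltn ?ltnS ?ltim//; apply/esym/eq_dig.
  by rewrite eq_ee' lerD2l.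
- move=> e Pe.
  have P'e : P' e by apply: (PP' _ (e m.+1)); rewrite upd_id.
  have [e' Q'e' e'0] := Q'ex _ P'e.
  have [v /sP[w []]] := P'P _ (Q'P' _ Q'e').
  rewrite upd_upd => Pw maxw _; exists (upd e' m.+1 w); last by rewrite upd_neq.
  rewrite Pw (qf_local (e' := e') qQ') ?Q'e'/=; last first.
    by move=> i ltim; rewrite upd_neq// neq_ltn ltim.
  apply/allP => p ps; have [p_gt0 lp] := gs p ps.
  rewrite -implybE; apply/implyP => /(subst_candP _ _ _ p_gt0)[x].
  rewrite upd_eq upd_upd lin_upd// => <- Px.
  by rewrite ler_pM2l//; apply: maxw; rewrite upd_upd.
Qed.

(* [q] stands for the affine functions [t |-> q.1.2 i * t + q.2 i], giving a
   point of [P] at each [t] where [q.1.1] holds. *)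
Definition affine_section (F : numFieldType) (m : nat) (P : env -> bool)
    (q : (env -> bool) * (nat -> F) * (nat -> F)) :=
  qf 1 q.1.1 /\ forall e, q.1.1 e -> exists e', [/\ e' 0%N = e 0%N, P e' &
    forall i, (i <= m)%N -> (e' i)%:~R = q.1.2 i * (e 0%N)%:~R + q.2 i].

(** A candidate equation [p.1 * v = p.2 e] makes the last digit affine in the others, hence affine
    in [t] by induction. Dividing by [p.1] gives rational coefficients, whence the field [F]. *)
Lemma qf_sections (F : numFieldType) m P :
  qf m.+1 P -> (forall e, P e -> boxed m e) ->
  exists s : seq ((env -> bool) * (nat -> F) * (nat -> F)),
    {in s, forall q, affine_section m P q} /\
    forall e, P e -> exists2 q, q \in s & q.1.1 e.
Proof.
elim: m P => [|m IHm] P qP bP.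
  exists [:: (P, (fun=> 1), (fun=> 0))]; split.
    move=> q; rewrite inE => /eqP->; split=> //= e Pe; exists e; split=> // i.
    by rewrite leqn0 => /eqP->; rewrite mul1r addr0.
  by move=> e Pe; exists (P, (fun=> 1), (fun=> 0)) => //; rewrite mem_head.
have [s [gs sP]] := qf_elim qP bP.
have /choice[l lP] : forall p : cand, exists l : seq ((env -> bool) * (nat -> F) * (nat -> F)),
    p \in s -> {in l, forall q, affine_section m.+1 P q} /\
    forall e, subst_cand m.+1 P p e -> exists2 q, q \in l & q.1.1 e.
  move=> p; case: (boolP (p \in s)) => [/gs gp|_]; last by exists [::].
  have [b_gt0 lf] := gp.
  have bsubst e : subst_cand m.+1 P p e -> boxed m e.
    move=> /(subst_candP _ _ _ b_gt0)[v _ /bP/boxedP be].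
    apply/boxedP => i /andP[i_gt0 leim].
    by have := be i; rewrite !upd_neq ?neq_ltn ?ltnS ?leim// i_gt0 ltnW// => ->.
  have [l [lsec lex]] := IHm _ (qf_subst gp qP) bsubst.
  have [c [a pE]] := lf.
  pose al (q : (env -> bool) * (nat -> F) * (nat -> F)) i : F := if i == m.+1 then
    (\sum_(j < m.+1) (a j)%:~R * q.1.2 j) / p.1%:~R else q.1.2 i.
  pose be (q : (env -> bool) * (nat -> F) * (nat -> F)) i : F := if i == m.+1 then
    (c%:~R + \sum_(j < m.+1) (a j)%:~R * q.2 j) / p.1%:~R else q.2 i.
  exists [seq (q.1.1, al q, be q) | q <- l] => _; split.
    move=> _ /mapP[q /lsec[qq qsec] ->]; split=> //= e /qsec[e' [e'0 sube' e'E]].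
    have [v bv Pv] := subst_candP _ _ _ b_gt0 sube'.
    exists (upd e' m.+1 v); split=> // i.
    rewrite leq_eqVlt => /orP[/eqP->|ltim]; last first.
      have ni : i != m.+1 by rewrite neq_ltn ltim.
      by rewrite (upd_neq _ _ ni) /al /be (negPf ni); apply: e'E.
    rewrite upd_eq /al /be eqxx mulrAC -mulrDl.
    have b_neq0 : p.1%:~R != 0 :> F by rewrite intr_eq0 gt_eqF.
    apply: (canRL (mulfK b_neq0)); rewrite mulrC -intrM bv pE intrD.
    rewrite addrCA; congr (_ + _).
    rewrite mulr_suml -big_split rmorph_sum; apply: eq_bigr => j _ /=.
    have lejm : (j <= m)%N by rewrite -ltnS.
    by rewrite intrM (e'E _ lejm) mulrDr mulrA.
  move=> e /lex[q ql qe]; exists (q.1.1, al q, be q) => //.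
  by apply/mapP; exists q.
exists (flatten [seq l p | p <- s]); split.
  by move=> q /flatten_mapP[p ps ql]; exact: (lP p ps).1.
move=> e /sP[v [Pv _ [p ps pv]]].
have [|q ql qe] := (lP p ps).2 e.
  by apply/subst_candP; [case: (gs _ ps)|exists v].
by exists q => //; apply/flatten_mapP; exists p.
Qed.

(** * Eventual periodicity in one variable *)

(** A linear function of [t] keeps its sign beyond [|c|], and divisibility by [d] has period [d];
    conjunctions multiply the periods and take the larger threshold. *)
Lemma qf1_periodic P : qf 1 P -> exists (D : nat) (N : int), (0 < D)%N /\
  forall e e', N <= e 0%N -> N <= e' 0%N -> (D %| e' 0%N - e 0%N)%Z -> P e = P e'.
Proof.
elim=> {P}.
- move=> f [c [a fE]]; exists 1%N, (`|c| + 1); split=> // e e' eN e'N _.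
  by rewrite !fE !big_ord1 /=; case: (ltrgtP (a 0%N) 0) => [?|?|->]; nia.
- move=> d f d_gt0 [c [a fE]]; exists (absz d), 0; split; first by lia.
  move=> e e' _ _; rewrite gez0_abs; last exact: ltW.
  move=> dee'; rewrite !fE !big_ord1 /=.
  have -> : c + a 0%N * e' 0%N = a 0%N * (e' 0%N - e 0%N) + (c + a 0%N * e 0%N) by ring.
  by rewrite [RHS]rpredDl// dvdz_mull.
- move=> P Q _ [D1 [N1 [D1_gt0 IHP]]] _ [D2 [N2 [D2_gt0 IHQ]]].
  exists (D1 * D2)%N, (Num.max N1 N2); split; first by rewrite muln_gt0 D1_gt0.
  move=> e e'; rewrite !ge_max => /andP[? ?] /andP[? ?] dee'.
  rewrite (IHP e e')// 1?(IHQ e e')//; apply: dvdz_trans dee'; rewrite PoszM.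
    exact: dvdz_mull.
  exact: dvdz_mulr.
- move=> P _ [D [N [D_gt0 IHP]]]; exists D, N; split=> // e e' eN e'N dee'.
  by rewrite (IHP e e').
- move=> P Q _ [D [N [D_gt0 IHP]]] PQ; exists D, N; split=> // e e' eN e'N dee'.
  by rewrite -!PQ (IHP e e').
Qed.

Lemma qf1_periodic_seq (s : seq (env -> bool)) : {in s, forall P, qf 1 P} ->
  exists (D : nat) (N : int), (0 < D)%N /\ {in s, forall P : env -> bool,
  forall e e', N <= e 0%N -> N <= e' 0%N -> (D %| e' 0%N - e 0%N)%Z -> P e = P e'}.
Proof.
elim: s => [_|P s IHs qs]; first by exists 1%N, 0.
have [D1 [N1 [D1_gt0 IHP]]] := qf1_periodic (qs P (mem_head _ _)).
have [|D2 [N2 [D2_gt0 IH]]] := IHs; first by move=> Q Qs; apply: qs; rewrite inE Qs orbT.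
exists (D1 * D2)%N, (Num.max N1 N2); split; first by rewrite muln_gt0 D1_gt0.
move=> Q; rewrite inE => Qs e e'; rewrite !ge_max => /andP[? ?] /andP[? ?].
rewrite PoszM => dee'.
have dv1 : (D1 %| e' 0%N - e 0%N)%Z by apply: dvdz_trans dee'; exact: dvdz_mulr.
have dv2 : (D2 %| e' 0%N - e 0%N)%Z by apply: dvdz_trans dee'; exact: dvdz_mull.
by case/orP: Qs => [/eqP->|Qs]; [exact: IHP|exact: IH].
Qed.

(** * Base [t] expansions and carries *)

(** Horner form of [w0 + t * w1 + t^2 * w2 + ...] with every [wi] linear; it exposes the lowest
    term, from which a carry is extracted. *)
Inductive tpoly (n : nat) : (env -> int) -> Prop :=
| tpoly0 : tpoly n (fun=> 0)
| tpolyS w g : lin n w -> tpoly n g -> tpoly n (fun e => w e + e 0%N * g e)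
| tpoly_ext g h : tpoly n g -> g =1 h -> tpoly n h.

Lemma tpoly_lin n w : lin n w -> tpoly n w.
Proof.
by move=> lw; apply: tpoly_ext (tpolyS lw (tpoly0 n)) _ => e; rewrite mulr0 addr0.
Qed.

Lemma tpolyD n g h : tpoly n g -> tpoly n h -> tpoly n (fun e => g e + h e).
Proof.
move=> tg; elim: tg h => {g} [h th|w g lw _ IHg h th|g g' _ IHg gg' h th].
- by apply: tpoly_ext th _ => e; rewrite add0r.
- elim: th => {h} [|w' h lw' th _|h h' _ IHh hh'].
  + by apply: tpoly_ext (tpolyS lw (IHg _ (tpoly0 n))) _ => e; rewrite !addr0.
  + by apply: tpoly_ext (tpolyS (linD lw lw') (IHg _ th)) _ => e; rewrite mulrDr addrACA.
  + by apply: tpoly_ext IHh _ => e; rewrite hh'.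
- by apply: tpoly_ext (IHg _ th) _ => e; rewrite gg'.
Qed.

Lemma tpolyZ n k g : tpoly n g -> tpoly n (fun e => k * g e).
Proof.
elim=> {g} [|w g lw _ IHg|g h _ IHg gh].
- by apply: tpoly_ext (tpoly0 n) _ => e; rewrite mulr0.
- by apply: tpoly_ext (tpolyS (linZ k lw) IHg) _ => e; rewrite mulrDr [k * (_ * _)]mulrCA.
- by apply: tpoly_ext IHg _ => e; rewrite gh.
Qed.

Lemma tpolyX n g : tpoly n g -> tpoly n (fun e => e 0%N * g e).
Proof.
by move=> tg; apply: tpoly_ext (tpolyS (lin_cst n 0) tg) _ => e; rewrite add0r.
Qed.

Lemma tpoly_horner n (p : {poly int}) g :
  tpoly n g -> tpoly n (fun e => p.[e 0%N] * g e).
Proof.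
move=> tg; elim/poly_ind: p => [|p c IHp].
  by apply: tpoly_ext (tpoly0 n) _ => e; rewrite horner0 mul0r.
apply: tpoly_ext (tpolyD (tpolyX IHp) (tpolyZ c tg)) _ => e.
by rewrite hornerMXaddC mulrDl mulrCA mulrA.
Qed.

Lemma tpoly_sum n (I : Type) (r : seq I) (F : I -> env -> int) :
  (forall i, tpoly n (F i)) -> tpoly n (fun e => \sum_(i <- r) F i e).
Proof.
move=> tF; elim: r => [|i r IHr].
  by apply: tpoly_ext (tpoly0 n) _ => e; rewrite big_nil.
by apply: tpoly_ext (tpolyD (tF i) IHr) _ => e; rewrite big_cons.
Qed.

Lemma tpoly_base_val n q r : (q + r < n)%N ->
  tpoly n (fun e => base_val (e 0%N) (fun k => e (q + k).+1) r).
Proof.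
elim: r => [|r IHr] ltn; first exact: tpoly0.
apply: tpoly_ext (tpolyS (lin_var (i := (q + r).+1) _) (IHr _)) _ => [||e /=]; [lia|lia|].
by rewrite addrC mulrC.
Qed.

Definition digit_dom n (e : env) := (0 < e 0%N) && boxed n e.

Lemma qf_digit_dom n : qf n.+1 (digit_dom n).
Proof.
apply: qf_and.
  have lf : lin n.+1 (fun e => e 0%N + -1) by apply: linD (lin_var _) (lin_cst _ _).
  by apply: qf_ext (qf_ge0 lf) _ => e; lia.
apply: (@qf_all _ _ _ (fun i e => (0 <= e i) && (e i < e 0%N))) => i.
rewrite mem_iota add1n => /andP[_ lein].
apply: qf_and; first exact/qf_ge0/lin_var.
apply: qf_ext (qf_not (qf_le (lin_var (ltn0Sn n)) (lin_var lein))) _ => e.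
by rewrite -ltNge.
Qed.

(** Every digit is below [t] and [t] is at least one, so the sum of the absolute coefficients
    serves. The bound makes the range of the carries independent of [t]. *)
Lemma lin_bound n w : lin n.+1 w -> exists C : nat,
  forall e, digit_dom n e -> `|w e| <= C%:Z * e 0%N.
Proof.
move=> [c [a wE]]; exists (absz (c : int) + \sum_(i < n.+1) absz (a i))%N.
move=> e /andP[t_gt0 /boxedP be]; rewrite wE PoszD mulrDl.
apply: le_trans (ler_normD _ _) _; apply: lerD; first by rewrite abszE ler_peMr//; lia.
rewrite (big_morph Posz PoszD (erefl 0%:Z)) mulr_suml.
apply: le_trans (ler_norm_sum _ _ _) _; apply: ler_sum => -[[|i] ltin] _ /=.
  by rewrite normrM abszE (gtr0_norm t_gt0).
rewrite normrM abszE; apply: ler_wpM2l => //.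
by have := be i.+1 ltin; lia.
Qed.

(* Dividing the equation by [t] digit by digit leaves a carry at each step;
   since the digits are below [t], it takes finitely many values. *)
Lemma qf_tpoly_eq0 n g : tpoly n.+1 g ->
  qf n.+1 (fun e => digit_dom n e && (g e == 0)).
Proof.
(* The additional linear term [w] absorbs the incoming carry, so the induction has to leave it
   arbitrary. *)
move=> tg; suff qw w : lin n.+1 w ->
    qf n.+1 (fun e => digit_dom n e && (w e + e 0%N * g e == 0)).
  by apply: qf_ext (qw _ (lin_cst _ 0)) _ => e;
    case: (boolP (digit_dom n e)) => //= /andP[t_gt0 _];
    rewrite add0r mulf_eq0 gt_eqF.
elim: tg w => {g} [|w' g lw' _ IHg|g h _ IHg gh] w lw.
- apply: qf_ext (qf_and (qf_digit_dom n) (qf_eq lw (lin_cst _ 0))) _ => e.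
  by rewrite mulr0 addr0.
- have [C wC] := lin_bound lw.
  (* The carry [c] is determined by [w e = c * t]; dividing the equation by [t] leaves [c] added to
     the next coefficient. *)
  pose F (c : int) e := (w e == c * e 0%N) &&
    (digit_dom n e && (c + w' e + e 0%N * g e == 0)).
  have qF : qf n.+1 (fun e => has (F^~ e) [seq k%:Z - C%:Z | k <- iota 0 (C + C).+1]).
    apply: (@qf_has _ _ _ F) => c _; apply: qf_and.
      exact: qf_eq lw (linZ c (lin_var _)).
    exact: IHg _ (linD (lin_cst _ c) lw').
  apply: qf_ext qF _ => e; apply/hasP/idP.
    move=> [c _ /and3P[/eqP-> -> /eqP h]] /=.
    by apply/eqP; rewrite -[RHS](mulr0 (e 0%N)) -h; ring.
  move=> /andP[de /eqP h]; have := wC e de; have /andP[t_gt0 _] := de.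
  set Y := w' e + e 0%N * g e in h *; move=> wY.
  have wE : w e = - Y * e 0%N by lia.
  have YC : - C%:Z <= Y <= C%:Z by move: wY; rewrite wE; nia.
  exists (- Y); last by rewrite /F de wE eqxx /= -addrA addNr.
  by apply/mapP; exists (absz (C%:Z - Y)%R); [rewrite mem_iota; lia|lia].
- by apply: qf_ext (IHg _ lw) _ => e; rewrite gh.
Qed.

(** * Fourier-Motzkin elimination *)

Definition cstr := ((nat -> int) * int)%type.

Definition sat (F : realFieldType) n (x : nat -> F) (p : cstr) :=
  \sum_(i < n) (p.1 i)%:~R * x i <= p.2%:~R.

Definition small_cstr (H : int) (p : cstr) := (forall i, `|p.1 i| <= H) /\ `|p.2| <= H.

(** Serves to choose the value of an eliminated variable between its lower and upper bounds; either
    list may be empty. *)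
Lemma seq_separation (F : realFieldType) (lo hi : seq F) :
  {in lo & hi, forall l h, l <= h} ->
  exists v, {in lo, forall l, l <= v} /\ {in hi, forall h, v <= h}.
Proof.
elim: lo => [_|l lo IHlo lohi].
  elim: hi => [|h hi [v [_ vP]]]; first by exists 0.
  exists (Num.min h v); split=> // k; rewrite inE => /orP[/eqP->|/vP le_vk].
    by rewrite ge_min lexx.
  by rewrite ge_min le_vk orbT.
have [|v [lov vhi]] := IHlo.
  by move=> a h alo hhi; apply: lohi; rewrite ?inE ?alo ?orbT.
exists (Num.max l v); split=> [a|h hhi].
  by rewrite inE => /orP[/eqP->|/lov le_av]; rewrite le_max ?lexx// le_av orbT.
by rewrite ge_max vhi// andbT; apply: lohi => //; rewrite mem_head.
Qed.

(** For [p.1 n > 0] and [q.1 n < 0] the multipliers are positive and the variable [n] cancels;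
    avoiding division keeps the coefficients integral. *)
Definition comb_cstr n (p q : cstr) : cstr :=
  (fun i => - q.1 n * p.1 i + p.1 n * q.1 i, - q.1 n * p.2 + p.1 n * q.2).

Definition fm_elim n (s : seq cstr) : seq cstr :=
  [seq p <- s | p.1 n == 0] ++
  [seq comb_cstr n p q | p <- [seq p <- s | 0 < p.1 n], q <- [seq q <- s | q.1 n < 0]].

Lemma sat_comb (F : realFieldType) n (x : nat -> F) (p q : cstr) :
  \sum_(i < n) ((comb_cstr n p q).1 i)%:~R * x i =
  - (q.1 n)%:~R * (\sum_(i < n) (p.1 i)%:~R * x i) +
  (p.1 n)%:~R * (\sum_(i < n) (q.1 i)%:~R * x i).
Proof.
rewrite !mulr_sumr -big_split; apply: eq_bigr => i _ /=.
by rewrite intrD !intrM intrN mulrDl !mulrA.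
Qed.

(** A combined entry is a sum of two products of entries, hence at most [2 * t^(2k)], and the factor
    [2] is absorbed by one more [t]. *)
Lemma fm_elim_small n k (t : int) s : 2 <= t ->
  {in s, forall p, small_cstr (t ^+ k) p} ->
  {in fm_elim n s, forall p, small_cstr (t ^+ (k + k).+1) p}.
Proof.
move=> t2 ss p.
have tk1 : 1 <= t ^+ k by apply: exprn_ege1; lia.
have tkE : t ^+ (k + k).+1 = t * (t ^+ k * t ^+ k) by rewrite exprS exprD.
have le1 : t ^+ k <= t ^+ (k + k).+1 by rewrite tkE; nia.
have comb a b c d : `|a| <= t ^+ k -> `|b| <= t ^+ k -> `|c| <= t ^+ k -> `|d| <= t ^+ k ->
    `|- a * b + c * d| <= t ^+ (k + k).+1.
  move=> ha hb hc hd; apply: le_trans (ler_normD _ _) _; rewrite !normrM normrN tkE.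
  have h1 : `|a| * `|b| <= t ^+ k * t ^+ k by apply: ler_pM.
  have h2 : `|c| * `|d| <= t ^+ k * t ^+ k by apply: ler_pM.
  apply: le_trans (lerD h1 h2) _; rewrite -mulr2n -mulr_natl ler_wpM2r//.
  by rewrite mulr_ge0// (le_trans _ tk1).
rewrite mem_cat mem_filter => /orP[/andP[_ /ss[h1 h2]]|].
  by split=> [i|]; [exact: le_trans (h1 i) le1|exact: le_trans h2 le1].
move=> /allpairsP[[a b] [/=]]; rewrite !mem_filter.
move=> /andP[_ /ss[a1 a2]] /andP[_ /ss[b1 b2]] ->.
by split=> [i|] /=; apply: comb.
Qed.

Lemma fm_elim_sat (F : realFieldType) n s (x : nat -> F) :
  all (sat n.+1 x) s -> all (sat n x) (fm_elim n s).
Proof.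
move=> /allP ss; apply/allP => p; rewrite mem_cat mem_filter => /orP[/andP[/eqP p0 /ss]|].
  by rewrite /sat big_ord_recr /= p0 mul0r addr0.
move=> /allpairsP[[a b] [/=]]; rewrite !mem_filter.
move=> /andP[a_gt0 /ss sa] /andP[b_lt0 /ss sb] ->; move: sa sb.
rewrite /sat !big_ord_recr /= (sat_comb _ _ a b) => sa sb.
rewrite intrD !intrM intrN.
have a0 : 0 < (a.1 n)%:~R :> F by rewrite ltr0z.
have b0 : (b.1 n)%:~R < 0 :> F by rewrite ltrz0.
have nb0 : 0 <= - (b.1 n)%:~R :> F by rewrite oppr_ge0 ltW.
by have := ler_wpM2l (ltW a0) sb; have := ler_wpM2l nb0 sa; lra.
Qed.

Lemma fm_elim_lift (F : realFieldType) n s (x : nat -> F) :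
  all (sat n x) (fm_elim n s) -> exists v, all (sat n.+1 (upd x n v)) s.
Proof.
move=> /allP ss.
pose S (p : cstr) : F := \sum_(i < n) (p.1 i)%:~R * x i.
(* The bound that [p] puts on variable [n], from above if [p.1 n > 0] and from below if [p.1 n < 0].
   The combined constraints say that no lower bound exceeds an upper one. *)
pose rt (p : cstr) : F := (p.2%:~R - S p) / (p.1 n)%:~R.
have [|v [lov vhi]] := @seq_separation F [seq rt q | q <- [seq q <- s | q.1 n < 0]]
    [seq rt p | p <- [seq p <- s | 0 < p.1 n]].
  move=> _ _ /mapP[q + ->] /mapP[p + ->]; rewrite !mem_filter.
  move=> /andP[q_lt0 qs] /andP[p_gt0 ps].
  have /ss : comb_cstr n p q \in fm_elim n s.
    rewrite mem_cat; apply/orP; right; apply/allpairsP; exists (p, q).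
    by rewrite !mem_filter p_gt0 q_lt0.
  rewrite /sat sat_comb -!/(S _) /= intrD !intrM intrN => h.
  have p0 : 0 < (p.1 n)%:~R :> F by rewrite ltr0z.
  have q0 : (q.1 n)%:~R < 0 :> F by rewrite ltrz0.
  rewrite /rt ler_pdivlMr// mulrAC ler_ndivrMr//; lra.
exists v; apply/allP => p ps; rewrite /sat big_ord_recr /= upd_eq.
rewrite (eq_bigr (fun i : 'I_n => (p.1 i)%:~R * x i)) -?/(S p); last first.
  by move=> i _; rewrite upd_neq// neq_ltn ltn_ord.
case: (ltrgtP (p.1 n) 0) => p0.
- have /lov : rt p \in [seq rt q | q <- [seq q <- s | q.1 n < 0]].
    by apply: map_f; rewrite mem_filter p0.
  have pF : (p.1 n)%:~R < 0 :> F by rewrite ltrz0.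
  by rewrite /rt ler_ndivrMr//; lra.
- have /vhi : rt p \in [seq rt p | p <- [seq p <- s | 0 < p.1 n]].
    by apply: map_f; rewrite mem_filter p0.
  have pF : 0 < (p.1 n)%:~R :> F by rewrite ltr0z.
  by rewrite /rt ler_pdivlMr//; lra.
- have : p \in fm_elim n s by rewrite mem_cat mem_filter p0 eqxx ps.
  by move=> /ss; rewrite /sat -/(S p) p0 mul0r addr0.
Qed.

(** Eliminating all variables but [0] leaves one-variable constraints. One with a positive
    coefficient, which is at least [1], bounds the variable by a power of [t]; without one, the
    variable can grow at will. The exponent depends only on [n] and [k]. *)
Lemma fm_dichotomy n k : exists K : nat, forall (F : realFieldType) (t : int) (s : seq cstr),
  2 <= t -> {in s, forall p, small_cstr (t ^+ k) p} ->
  (forall x : nat -> F, all (sat n.+1 x) s -> x 0%N <= (t ^+ K)%:~R) \/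
  (forall (x : nat -> F) (M : F), all (sat n.+1 x) s ->
    exists2 y : nat -> F, all (sat n.+1 y) s & M <= y 0%N).
Proof.
elim: n k => [|n IHn] k.
  exists k => F t s t2 ss.
  case: (boolP (has (fun p => 0 < p.1 0%N) s)) => [/hasP[p ps /= p_gt0]|].
    left=> x /allP/(_ p ps); rewrite /sat big_ord1 /= => h.
    have p1 : 1 <= (p.1 0%N)%:~R :> F by rewrite ler1z -gtz0_ge1.
    have h2 : p.2%:~R <= (t ^+ k)%:~R :> F.
      by rewrite ler_int; apply: le_trans (ler_norm _) (ss p ps).2.
    have [x_ge0|x_lt0] := lerP 0 (x 0%N).
      apply: le_trans h2; apply: le_trans h.
      by rewrite ler_peMl.
    apply: le_trans (ltW x_lt0) _; rewrite ler0z exprn_ge0//; lia.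
  rewrite -all_predC => /allP neg; right=> x M /allP sx.
  exists (fun=> Num.max (x 0%N) M); last by rewrite le_max lexx orbT.
  apply/allP => p ps; have := sx p ps; rewrite /sat !big_ord1 /=.
  apply: le_trans; rewrite ler_wnM2l//; last by rewrite le_max lexx.
  by rewrite lerz0 leNgt; exact: neg.
(* Each elimination turns the exponent [k] into [2k + 1]. *)
have [K IH] := IHn (k + k).+1; exists K => F t s t2 ss.
have [bnd|unb] := IH F t (fm_elim n.+1 s) t2 (fm_elim_small (n := n.+1) t2 ss); [left|right].
  by move=> x /fm_elim_sat/bnd.
move=> x M /fm_elim_sat sx; have [y /fm_elim_lift[v sy] My] := unb x M sx.
by exists (upd y n.+1 v) => //; rewrite upd_neq.
Qed.

(** * Polynomial bounds on the integer points *)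

Lemma horner_bound (p : {poly int}) : exists K : nat, forall (k : nat) (t : int),
  (K <= k)%N -> K%:Z <= t -> `|p.[t]| <= t ^+ k.
Proof.
elim/poly_ind: p => [|p c [K IHp]].
  exists 0%N => k t _ t_ge0; rewrite horner0 normr0 exprn_ge0//.
exists (K + absz (c : int) + 2)%N => -[|[|k]] t leKk leKt; [lia|lia|].
have t2 : 2 <= t by lia.
have h1 : `|p.[t]| <= t ^+ k by apply: IHp; lia.
have tk : 1 <= t ^+ k by apply: exprn_ege1; lia.
rewrite hornerMXaddC !exprS.
apply: le_trans (ler_normD _ _) _; rewrite normrM (ger0_norm (x := t)); last by lia.
have : `|c| <= t * t ^+ k by rewrite -abszE; nia.
have : `|p.[t]| * t <= t * t ^+ k by nia.
nia.
Qed.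

Lemma ex_uniform (I : finType) (P : I -> nat -> Prop) :
  (forall i, exists K, forall k, (K <= k)%N -> P i k) ->
  exists K, forall i k, (K <= k)%N -> P i k.
Proof.
move=> /choice[K KP]; exists (\max_i K i) => i k leKk.
by apply: KP; apply: leq_trans leKk; apply: leq_bigmax.
Qed.

Lemma matrix_bound p q (M : 'M[{poly int}]_(p, q)) : exists K : nat,
  forall k, (K <= k)%N -> forall (t : int) i j, k%:Z <= t -> `|(M i j).[t]| <= t ^+ k.
Proof.
have [|K KP] := @ex_uniform ('I_p * 'I_q)%type (fun ij k => forall t : int, k%:Z <= t ->
    `|(M ij.1 ij.2).[t]| <= t ^+ k).
  move=> [i j]; have [K KP] := horner_bound (M i j); exists K => k leKk t lekt.
  by apply: KP => //; lia.
by exists K => k leKk t i j lekt; apply: (KP (i, j)).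
Qed.

Definition ord_ext (T : Type) (d : T) n (f : 'I_n -> T) (i : nat) : T :=
  if insub i is Some j then f j else d.

Lemma ord_extE (T : Type) (d : T) n (f : 'I_n -> T) (i : 'I_n) : ord_ext d f i = f i.
Proof. by rewrite /ord_ext valK. Qed.

Lemma ord_ext_ind (T : Type) (d : T) n (f : 'I_n -> T) (P : T -> Prop) i :
  P d -> (forall j, P (f j)) -> P (ord_ext d f i).
Proof. by move=> Pd Pf; rewrite /ord_ext; case: insubP. Qed.

Lemma coord_le_norm (R : realType) n (x : 'cV[R]_n) j : `|x j 0| <= `|x|.
Proof.
rewrite [leRHS]/Num.Def.normr /= mx_normrE; apply/bigmax_geP; right => /=.
by exists (j, 0).
Qed.

(* The variables are [0] for the coordinate [j0] to be bounded and [j.+1] for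
   the coordinate [j] of the point. *)
Definition succ_coef n (f : 'I_n -> int) (i : nat) : int :=
  if i is k.+1 then ord_ext 0 f k else 0.

(** Variable [0] is capped by the coordinate [j0] and otherwise free, so it is bounded above exactly
    when that coordinate is; [fm_dichotomy] speaks of variable [0]. *)
Definition point_constraints n m (A : 'M[{poly int}]_(m, n))
    (b : 'cV[{poly int}]_m) (t : int) (j0 : 'I_n) : seq cstr :=
  [:: (fun i => if i is 0%N then 1 else succ_coef (fun j => - (j == j0)%:R) i, 0)] ++
  [seq (succ_coef (fun j => - (j == k)%:R), 0) | k <- enum 'I_n] ++
  [seq (succ_coef (fun j => (A k j).[t]), (b k 0).[t]) | k <- enum 'I_m] ++
  [seq (succ_coef (fun j => - (A k j).[t]), - (b k 0).[t]) | k <- enum 'I_m].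

Lemma sum_succ_coef (F : realFieldType) n (f : 'I_n -> int) (x : nat -> F) :
  \sum_(i < n.+1) (succ_coef f i)%:~R * x i = \sum_(j < n) (f j)%:~R * x j.+1.
Proof.
rewrite big_ord_recl /= mul0r add0r; apply: eq_bigr => j _.
by rewrite /succ_coef /= ord_extE.
Qed.

Lemma sum_delta (F : realFieldType) n (j0 : 'I_n) (x : nat -> F) :
  \sum_(j < n) (- (j == j0)%:R : int)%:~R * x j.+1 = - x j0.+1.
Proof.
rewrite (bigD1 j0)//= eqxx mulN1r big1 ?addr0// => j /negPf->.
by rewrite oppr0 mul0r.
Qed.

Lemma sat_point_constraints (R : realType) n m (A : 'M[{poly int}]_(m, n))
    (b : 'cV[{poly int}]_m) (t : int) (j0 : 'I_n) (x : nat -> R) :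
  all (sat n.+1 x) (point_constraints A b t j0) <->
  real_points R A b t (\col_j x j.+1) /\ x 0%N <= x j0.+1.
Proof.
have rowE k : (map_mx intr (eval_mx A t) *m (\col_j x j.+1 : 'cV[R]_n)) k 0 =
    \sum_(j < n) ((A k j).[t])%:~R * x j.+1.
  by rewrite mxE; apply: eq_bigr => j _; rewrite !mxE.
split.
  rewrite !all_cat !all_map => /and4P[/andP[h0 _] /allP h1 /allP h2 /allP h3].
  split; first split.
  - move=> j; have := h1 j; rewrite -enumT mem_enum => /(_ isT).
    by rewrite mxE /= /sat sum_succ_coef sum_delta oppr_le0.
  - apply/colP => k; rewrite rowE !mxE; apply/eqP; rewrite eq_le.
    have := h2 k; have := h3 k; rewrite -enumT mem_enum => /(_ isT) + /(_ isT).
    rewrite /= /sat !sum_succ_coef /= rmorphN /=.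
    under eq_bigr do rewrite rmorphN mulNr.
    by rewrite sumrN lerN2 => -> ->.
  - move: h0; rewrite /sat big_ord_recl /= mul1r.
    under eq_bigr do rewrite ord_extE.
    by rewrite sum_delta subr_le0.
move=> [[x_ge0 /colP Ax] x0]; rewrite !all_cat !all_map; apply/and4P; split.
- rewrite /= andbT /sat big_ord_recl /= mul1r.
  under eq_bigr do rewrite ord_extE.
  by rewrite sum_delta subr_le0.
- apply/allP => j _; rewrite /= /sat sum_succ_coef sum_delta oppr_le0.
  by have := x_ge0 j; rewrite mxE.
- apply/allP => k _; rewrite /= /sat sum_succ_coef -rowE Ax !mxE.
  exact: lexx.
- apply/allP => k _; rewrite /= /sat sum_succ_coef /=.
  under eq_bigr do rewrite rmorphN mulNr.
  by rewrite sumrN -rowE Ax !mxE rmorphN lexx.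
Qed.

Lemma point_constraints_small n m (A : 'M[{poly int}]_(m, n))
    (b : 'cV[{poly int}]_m) (t : int) (j0 : 'I_n) (H : int) : 1 <= H ->
  (forall i j, `|(A i j).[t]| <= H) -> (forall i j, `|(b i j).[t]| <= H) ->
  {in point_constraints A b t j0, forall p, small_cstr H p}.
Proof.
move=> H1 AH bH p.
have H0 : `|0 : int| <= H by rewrite normr0; lia.
have small_succ (f : 'I_n -> int) i : (forall j, `|f j| <= H) -> `|succ_coef f i| <= H.
  by move=> fH; case: i => // i; apply: (@ord_ext_ind _ _ _ _ (fun v => `|v| <= H)).
have deltaH k j : `|- (j == k :> 'I_n)%:R : int| <= H.
  by rewrite normrN; case: eqP => _ /=; rewrite ?normr1.
rewrite !mem_cat => /or4P[|/mapP[k _ ->]|/mapP[k _ ->]|/mapP[k _ ->]].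
- rewrite inE => /eqP->; split=> //= -[|i]; first by rewrite normr1.
  exact: (small_succ _ i.+1 (deltaH j0)).
- by split=> //= i; apply: small_succ => j; exact: deltaH.
- by split=> //= i; apply: small_succ.
- by split=> [i|]; rewrite /= ?normrN//; apply: small_succ => j; rewrite normrN.
Qed.

(** Boundedness of the real points excludes the unbounded alternative of [fm_dichotomy], so each
    coordinate is at most a power of [t] with an exponent independent of [t]. *)
Lemma integer_points_bound (R : realType) (n m : nat) (A : 'M[{poly int}]_(m, n))
    (b : 'cV[{poly int}]_m) :
  (forall t : int, 0 < t -> bounded_set (real_points R A b t)) ->
  exists K : nat, forall k, (K <= k)%N -> forall (t : int) (z : 'cV[int]_n) j,
    k%:Z <= t -> integer_points R A b t z -> 0 <= z j 0 <= t ^+ k.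
Proof.
move=> hb; have [KA hA] := matrix_bound A; have [Kb hB] := matrix_bound b.
pose k0 := maxn KA Kb.
have [K HK] := fm_dichotomy n k0.
exists (maxn 2 (maxn k0 K)) => k; rewrite !geq_max => /and3P[k2 lek0k leKk] t z j lekt Lz.
have t2 : 2 <= t by lia.
have z_ge0 i : 0 <= z i 0 by have := Lz.1 i; rewrite mxE ler0z.
rewrite z_ge0 /=.
have Hs := @point_constraints_small n m A b t j (t ^+ k0).
have {}Hs : {in point_constraints A b t j, forall p, small_cstr (t ^+ k0) p}.
  apply: Hs; first by apply: exprn_ege1; lia.
    by move=> i i'; apply: hA; rewrite ?leq_maxl//; lia.
  by move=> i i'; apply: hB; rewrite ?leq_maxr//; lia.
pose x i : R := if i is i'.+1 then (ord_ext 0 (fun i => z i 0) i')%:~R else (z j 0)%:~R.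
have satx : all (sat n.+1 x) (point_constraints A b t j).
  apply/sat_point_constraints; rewrite /= ord_extE; split=> //.
  suff -> : \col_i (ord_ext 0 (fun i => z i 0) i)%:~R = map_mx intr z :> 'cV[R]_n by [].
  by apply/colP => i; rewrite !mxE ord_extE.
have [bnd|unb] := HK R t _ t2 Hs.
  have := bnd x satx; rewrite /= ler_int => /le_trans; apply.
  by apply: ler_weXn2l => //; lia.
have t_gt0 : 0 < t by lia.
have [M [_ /(_ (M + 1))]] := hb t t_gt0; rewrite ltrDl ltr01 => /(_ isT) Mb.
(* [M + 1] bounds all norms, so a point whose coordinate [j] reaches [M + 2] is a contradiction. *)
have [y /sat_point_constraints[Ry y0] My] := unb x (M + 2) satx.
have h1 := coord_le_norm (\col_i y i.+1 : 'cV[R]_n) j; rewrite mxE in h1.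
have h2 : `|\col_i y i.+1 : 'cV[R]_n| <= M + 1 := Mb _ Ry.
have h3 : y j.+1 <= M + 1 := le_trans (ler_norm _) (le_trans h1 h2).
suff : M + 2 <= M + 1 by rewrite lerD2l leNgt ltr1n.
exact: le_trans My (le_trans y0 h3).
Qed.

(** * Values in decreasing order *)

(** Two sorted lists that are permutations of each other coincide. Only the point [x] is removed, so
    other points with the same value keep their entries. *)
Lemma sort_fset_max (T : choiceType) (S : set T) (v : T -> int) (x : T) :
  finite_set S -> S x -> (forall y, S y -> v y <= v x) ->
  sort >=%R [seq v z | z <- enum_fset (fset_set S)] =
  v x :: sort >=%R [seq v z | z <- enum_fset (fset_set (S `\ x))].
Proof.
move=> finS Sx vx.
have ge_trans : transitive (>=%R : rel int) by move=> a b c /= h1 h2; apply: le_trans h1.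
have ge_total : total (>=%R : rel int) by move=> a b /=; rewrite le_total.
have finSx : finite_set (S `\ x) by apply: sub_finite_set finS => y [].
apply: (sorted_eq ge_trans).
- by move=> a b /= /andP[h1 h2]; apply/eqP; rewrite eq_le h1 h2.
- exact: sort_sorted.
- rewrite /sorted path_sortedE// sort_sorted// andbT all_sort all_map.
  apply/allP => y; rewrite in_fset_set// inE => -[Sy _]; exact: vx.
- rewrite perm_sort; apply: (@perm_trans _ [seq v z | z <- x :: enum_fset (fset_set (S `\ x))]).
    apply/perm_map/uniq_perm => //.
      by rewrite /= fset_uniq andbT; apply/negP; rewrite in_fset_set// inE => -[_ []].
    move=> y; rewrite inE; apply: etrans (in_fset_set finS y) _.
    have -> : (y \in enum_fset (fset_set (S `\ x))) = (y \in (S `\ x)).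
      exact: in_fset_set finSx y.
    apply/idP/orP; rewrite !inE.
      by move=> Sy; case: (eqVneq y x) => [->|/eqP yx]; [left|right].
    by case=> [/eqP->|[]].
  by rewrite /= perm_cons perm_sym perm_sort.
Qed.

(** Positions count from [0] here, in contrast to [lth_largest]. *)
Definition nth_value (R : realType) (T : choiceType) (S : set T) (v : T -> int)
    (l : nat) : \bar R :=
  nth -oo%E [seq (i%:~R)%:E | i <- sort >=%R [seq v z | z <- enum_fset (fset_set S)]] l.

Definition decoded (T : Type) (P : env -> bool) (dec : env -> T) (t : int) : set T :=
  [set x | exists e, [/\ e 0%N = t, P e & dec e = x]].

(** The leading [r] digits encode the value shifted by [w], so the lexicographic maximum also
    maximises the value. The remaining digits break ties, which makes the maximiser unique for each
    [t]. *)
Lemma qf_decoded_max (T : Type) (m r : nat) (dec : env -> T) (v : int -> T -> int)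
    (w : int -> int) (P : env -> bool) :
  qf m.+1 P -> (forall e, P e -> boxed m e) -> (r <= m)%N ->
  (forall e, P e -> v (e 0%N) (dec e) = base_val (e 0%N) (digit e) r - w (e 0%N)) ->
  exists M, [/\ qf m.+1 M, forall e, M e -> P e,
    forall e, M e -> forall y, decoded P dec (e 0%N) y -> v (e 0%N) y <= v (e 0%N) (dec e),
    forall e e', M e -> M e' -> e 0%N = e' 0%N -> forall i, (i < m.+1)%N -> e i = e' i &
    forall e, P e -> exists2 e', M e' & e' 0%N = e 0%N].
Proof.
move=> qP bP lerm vE; have [M [qM MP Mmax Mex]] := qf_max qP bP.
have bd e e' : P e -> e 0%N = e' 0%N -> forall k, (k < m)%N -> 0 <= digit e k < e' 0%N.
  by move=> /bP/boxed_digit be <-.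
exists M; split=> //.
- move=> e Me _ [e' [e'0 Pe' <-]]; have Pe := MP _ Me.
  rewrite -{1}e'0 !vE// e'0 lerD2r.
  apply: (base_val_prefix (bd _ _ Pe' e'0) (bd _ _ Pe erefl) _ lerm).
  exact: Mmax.
- move=> e e' Me Me' ee' [|i]// ltim.
  apply: (base_val_inj (bd _ _ (MP _ Me) ee') (bd _ _ (MP _ Me') erefl) _ ltim).
  apply/eqP; rewrite eq_le (Mmax _ _ Me' (MP _ Me) ee') -ee' /=.
  exact: Mmax Me (MP _ Me') (esym ee').
Qed.

(* The [l]-th value is the maximum after the maximising point has been removed
   [l] times, each removal being a Boolean combination. *)
Lemma qf_nth_value (R : realType) (T : choiceType) (m r : nat) (dec : env -> T)
    (v : int -> T -> int) (w : int -> int) (l : nat) (P : env -> bool) :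
  (forall e e', (forall i, (i < m.+1)%N -> e i = e' i) -> dec e = dec e') ->
  qf m.+1 P -> (forall e, P e -> boxed m e) -> (r <= m)%N ->
  (forall e e', P e -> P e' -> e 0%N = e' 0%N -> dec e = dec e' ->
    forall i, (i < m.+1)%N -> e i = e' i) ->
  (forall e, P e -> v (e 0%N) (dec e) = base_val (e 0%N) (digit e) r - w (e 0%N)) ->
  exists Q, [/\ qf m.+1 Q, forall e, Q e -> boxed m e &
    forall t, finite_set (decoded P dec t) ->
      (forall e, e 0%N = t -> Q e -> nth_value R (decoded P dec t) (v t) l =
         ((base_val t (digit e) r - w t)%:~R)%:E) /\
      ((forall e, e 0%N = t -> ~~ Q e) -> nth_value R (decoded P dec t) (v t) l = -oo%E)].
Proof.
move=> dec_local + + lerm; elim: l P => [|l IHl] P qP bP inj_dec vE.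
  have [M [qM MP Mmax _ Mex]] := qf_decoded_max qP bP lerm vE.
  exists M; split=> // [e /MP/bP//|t fint]; split=> [e e0 Me|noM].
    have Pe := MP _ Me; subst t; rewrite /nth_value (sort_fset_max fint _ (Mmax e Me)).
      by rewrite /= vE.
    by exists e.
  suff -> : decoded P dec t = set0 by rewrite /nth_value fset_set0.
  apply/seteqP; split=> // x [e [e0 Pe _]]; have [e' Me' e'0] := Mex _ Pe.
  by have /negP[] := noM e' (etrans e'0 e0).
have [M [qM MP Mmax Muniq Mex]] := qf_decoded_max qP bP lerm vE.
pose P' e := P e && ~~ M e.
have [||||Q [qQ bQ QP]] := IHl P'.
- exact/qf_and/qf_not.
- by move=> e /andP[/bP].
- by move=> e e' /andP[+ _] /andP[+ _]; exact: inj_dec.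
- by move=> e /andP[/vE].
exists Q; split=> // t fint.
have sub' : (decoded P' dec t `<=` decoded P dec t).
  by move=> _ [e [e0 /andP[Pe _] <-]]; exists e.
suff -> : nth_value R (decoded P dec t) (v t) l.+1 = nth_value R (decoded P' dec t) (v t) l.
  by apply: QP; apply: sub_finite_set fint.
have [[e [e0 Me]]|noM] := pselect (exists e, e 0%N = t /\ M e).
  have Pe := MP _ Me; subst t.
  rewrite /nth_value (sort_fset_max fint _ (Mmax e Me)) /=; last by exists e.
  (* Injectivity of [dec] makes removing the maximal digit vector the same as removing one point. *)
  suff -> : decoded P' dec (e 0%N) = (decoded P dec (e 0%N) `\ dec e) by [].
  apply/seteqP; split=> [x Px|x].
    split; first exact: sub'.
    case: Px => e' [e'0 /andP[Pe' nMe'] <-] /= eqd; move/negP: nMe'; apply.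
    by rewrite (qf_local (e' := e) qM)//; exact: inj_dec.
  move=> [[e' [e'0 Pe' <-]] /= ndec]; exists e'; split=> //; rewrite /P' Pe'.
  by apply/negP => Me'; apply: ndec; apply: dec_local; exact: Muniq.
have P0 : decoded P dec t = set0.
  apply/seteqP; split=> // x [e [e0 Pe _]]; apply: noM.
  by have [e' Me' e'0] := Mex _ Pe; exists e'; rewrite e'0.
have P'0 : decoded P' dec t = set0 by rewrite P0 in sub'; apply/seteqP; split.
by rewrite /nth_value P0 P'0 fset_set0 /= !nth_nil.
Qed.

(** * From affine digits to quasi-polynomials *)

(** This is [base_val] with ['X] for [t] and an affine form for each digit; digit [q] is variable
    [q.+1], whence the shifted index. *)
Fixpoint base_poly (F : numFieldType) (a b : nat -> F) (r : nat) : {poly F} :=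
  if r is q.+1 then base_poly a b q * 'X + (a q.+1 *: 'X + (b q.+1)%:P) else 0.

Lemma horner_base_poly (F : numFieldType) (a b : nat -> F) e r :
  (forall i, (i <= r)%N -> (e i)%:~R = a i * (e 0%N)%:~R + b i) ->
  (base_poly a b r).[(e 0%N)%:~R] = (base_val (e 0%N) (digit e) r)%:~R.
Proof.
elim: r => [|r IHr] eE /=; first by rewrite horner0.
rewrite !hornerD hornerM hornerZ !hornerX hornerC IHr; last first.
  by move=> i leir; exact/eE/leqW.
by rewrite intrD intrM /digit (eE r.+1).
Qed.

(** By periodicity, a section whose condition holds at one large [t] of a residue class works at
    every large [t] of that class; if there is no such section, [P] has no point there and the value
    is [-oo]. *)
Lemma qf_eventually_quasi_polynomial (R : realType) (m r s : nat) (P : env -> bool)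
    (N0 : int) (g : int -> \bar R) :
  qf m.+1 P -> (forall e, P e -> boxed m e) -> (r <= m)%N ->
  (forall t e, N0 <= t -> e 0%N = t -> P e ->
    g t = ((base_val t (digit e) r - t ^+ s)%:~R)%:E) ->
  (forall t, N0 <= t -> (forall e, e 0%N = t -> ~~ P e) -> g t = -oo%E) ->
  eventually_quasi_polynomial [set t : int | 0 < t] g.
Proof.
move=> qP bP lerm gE gN; have [S [Ssec Sex]] := qf_sections R qP bP.
have [|D [N [D_gt0 perS]]] := @qf1_periodic_seq [seq q.1.1 | q <- S].
  by move=> _ /mapP[q /Ssec[qq _] ->].
pose N1 := Num.max N (Num.max N0 1).
suff /choice[p pE] : forall j : 'I_D, exists p : option {poly R}, forall t,
    N1 <= t -> (t %% D)%Z = j -> g t = poly_or_ninfty_eval p t%:~R.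
  exists D; split=> //; exists p, N1 => t tN; split=> [|j]; last exact: pE.
  by move: tN; rewrite !ge_max /= => /and3P[_ _]; lia.
move=> j; have [[q [qS [t0 [t0N t0j qt0]]]]|noq] := pselect (exists q, q \in S /\
    exists t0 : int, [/\ N1 <= t0, (t0 %% D)%Z = j & q.1.1 (fun=> t0)]).
  exists (Some (base_poly q.1.2 q.2 r - 'X^s)) => t tN tj.
  have qt : q.1.1 (fun=> t).
    move: tN t0N; rewrite !ge_max => /andP[tN _] /andP[t0N _].
    rewrite -(perS _ (map_f (fun q => q.1.1) qS) (fun=> t0))//.
    by rewrite -eqz_mod_dvd tj t0j.
  have [_ /(_ _ qt)[e [e0 Pe eE]]] := Ssec _ qS.
  rewrite (gE t e)//; last by move: tN; rewrite !ge_max => /and3P[].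
  rewrite /= hornerD hornerN hornerXn intrB -rmorphXn; congr (_ - _)%:E.
  by rewrite -e0 horner_base_poly// => i leir; rewrite e0; apply: eE; exact: leq_trans lerm.
exists None => t tN tj; apply: gN.
  by move: tN; rewrite !ge_max => /and3P[].
move=> e e0; apply/negP => Pe; have [q qS qe] := Sex _ Pe; apply: noq.
exists q; split=> //; exists t; split=> //.
have [qq _] := Ssec _ qS.
by rewrite (qf_local (e' := e) qq)// => -[|].
Qed.

Lemma finite_int_box n (H : int) :
  finite_set [set z : 'cV[int]_n | forall j, 0 <= z j 0 <= H].
Proof.
pose f (y : 'cV['I_(absz H).+1]_n) : 'cV[int]_n := \col_j (y j 0 : nat)%:Z.
apply: (@sub_finite_set _ _ (f @` setT)); last exact/finite_image/finite_finset.
move=> z zH; exists (\col_j inord (absz (z j 0))) => //.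
apply/colP => j; rewrite !mxE inordK; first by have := zH j; lia.
by have := zH j; lia.
Qed.

(** * Encoding the integer program *)

(* The digits of the [a]-th encoded integer in base [e 0] occupy the variables
   [a * r + 1, ..., a * r + r]. *)
Definition window (r a : nat) (e : env) : int :=
  base_val (e 0%N) (fun k => e (a * r + k).+1) r.

(** Coordinates start at window [1], because window [0], the most significant one, holds the shifted
    objective value. *)
Definition decode (n r : nat) (e : env) : 'cV[int]_n := \col_(j < n) window r j.+1 e.

Definition row_eq n m (A : 'M[{poly int}]_(m, n)) (b : 'cV[{poly int}]_m) r
    (i : 'I_m) (e : env) : int :=
  \sum_(j < n) (A i j).[e 0%N] * window r j.+1 e + (- b i 0).[e 0%N].

Definition obj_eq n (c : 'cV[{poly int}]_n) r s (e : env) : int :=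
  window r 0 e + \sum_(j < n) (- c j 0).[e 0%N] * window r j.+1 e
  + (- 'X^s).[e 0%N].

(** [digit_dom] is repeated in each conjunct because carries are bounded only on digit vectors. *)
Definition ip_digits n m (c : 'cV[{poly int}]_n) (A : 'M[{poly int}]_(m, n))
    (b : 'cV[{poly int}]_m) r s (e : env) : bool :=
  (digit_dom (n.+1 * r) e && (obj_eq c r s e == 0)) &&
  all (fun i => digit_dom (n.+1 * r) e && (row_eq A b r i e == 0)) (enum 'I_m).

Lemma tpoly_window n r a : (a <= n)%N -> tpoly (n.+1 * r).+1 (window r a).
Proof. by move=> lean; apply: tpoly_base_val; rewrite ltnS -mulSnr leq_mul2r ltnS lean orbT. Qed.

Lemma tpoly_horner_cst n (p : {poly int}) : tpoly n (fun e => p.[e 0%N]).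
Proof.
apply: tpoly_ext (tpoly_horner p (tpoly_lin (lin_cst n 1))) _ => e.
by rewrite mulr1.
Qed.

Lemma qf_ip_digits n m (c : 'cV[{poly int}]_n) (A : 'M[{poly int}]_(m, n))
    (b : 'cV[{poly int}]_m) r s : qf (n.+1 * r).+1 (ip_digits c A b r s).
Proof.
have tsum (F : 'I_n -> {poly int}) :
    tpoly (n.+1 * r).+1 (fun e => \sum_(j < n) (F j).[e 0%N] * window r j.+1 e).
  by apply: tpoly_sum => j; apply/tpoly_horner/tpoly_window.
apply: qf_and.
  apply: qf_tpoly_eq0; apply: tpolyD; last exact: tpoly_horner_cst.
  by apply: tpolyD; [exact: tpoly_window|exact: (tsum (fun j => - c j 0))].
apply: (@qf_all _ _ _ (fun i e => digit_dom (n.+1 * r) e && (row_eq A b r i e == 0))) => i _.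
apply: qf_tpoly_eq0; apply: tpolyD; last exact: tpoly_horner_cst.
exact: (tsum (A i)).
Qed.

Lemma ip_digitsP n m (c : 'cV[{poly int}]_n) (A : 'M[{poly int}]_(m, n))
    (b : 'cV[{poly int}]_m) r s (e : env) :
  ip_digits c A b r s e <-> [/\ digit_dom (n.+1 * r) e,
    window r 0 e = ((eval_mx c (e 0%N))^T *m decode n r e) 0 0 + e 0%N ^+ s &
    eval_mx A (e 0%N) *m decode n r e = eval_mx b (e 0%N)].
Proof.
have objE : obj_eq c r s e =
    window r 0 e - (((eval_mx c (e 0%N))^T *m decode n r e) 0 0 + e 0%N ^+ s).
  rewrite /obj_eq mxE hornerN hornerXn opprD addrA; congr (_ + _ - _).
  by rewrite -sumrN; apply: eq_bigr => j _; rewrite !mxE hornerN mulNr.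
have rowE i : row_eq A b r i e =
    (eval_mx A (e 0%N) *m decode n r e) i 0 - eval_mx b (e 0%N) i 0.
  rewrite /row_eq !mxE hornerN; congr (_ - _).
  by apply: eq_bigr => j _; rewrite !mxE.
rewrite /ip_digits; split=> [/andP[/andP[de /eqP obj0] /allP rows]|[de obj0 rows]].
  split=> //; first by apply/subr0_eq; rewrite -objE.
  apply/colP => i; apply/subr0_eq; rewrite -rowE.
  by have /andP[_ /eqP] := rows i (mem_enum _ _).
rewrite de objE obj0 subrr eqxx /=; apply/allP => i _.
by rewrite rowE rows subrr eqxx.
Qed.

Lemma digit_dom_window n r e a : (a <= n)%N -> digit_dom (n.+1 * r) e ->
  forall k, (k < r)%N -> 0 <= e (a * r + k).+1 < e 0%N.
Proof.
move=> lean /andP[_ /boxedP be] k ltkr; apply: be => /=.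
by rewrite mulSnr; have := leq_mul lean (leqnn r); lia.
Qed.

Lemma window_index n r i : (i < n.+1 * r)%N ->
  exists a k, [/\ (a <= n)%N, (k < r)%N & i = (a * r + k)%N].
Proof.
move=> lti; have r_gt0 : (0 < r)%N by case: r lti => //; rewrite muln0.
exists (i %/ r)%N, (i %% r)%N; split; [|exact: ltn_pmod|exact: divn_eq].
by rewrite -ltnS ltn_divLR.
Qed.

Lemma windows_exist n r (t : int) (X : nat -> int) : 0 < t ->
  (forall a, 0 <= X a < t ^+ r) ->
  exists e : env, [/\ e 0%N = t, digit_dom (n.+1 * r) e & forall a, window r a e = X a].
Proof.
move=> t_gt0 Xb.
have /choice[f fX] a := @base_val_exists t r (X a) t_gt0 (Xb a).
exists (fun i => if i is i'.+1 then f (i' %/ r)%N (i' %% r)%N else t); split=> //.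
  apply/andP; split=> //; apply/boxedP => -[//|i] /= lti.
  have [a [k [_ ltkr ->]]] := window_index lti.
  have r_gt0 : (0 < r)%N by apply: leq_ltn_trans ltkr.
  by rewrite divnMDl// divn_small// addn0 modnMDl modn_small//; apply: (fX a).1.
move=> a; rewrite -(fX a).2; apply: eq_base_val => k ltkr.
have r_gt0 : (0 < r)%N by apply: leq_ltn_trans ltkr.
by rewrite divnMDl// divn_small// addn0 modnMDl modn_small.
Qed.

Lemma decode_local n r e e' : (forall i, (i < (n.+1 * r).+1)%N -> e i = e' i) ->
  decode n r e = decode n r e'.
Proof.
move=> ee'; apply/colP => j; rewrite !mxE /window ee'//.
apply: eq_base_val => k ltkr; apply: ee'.
by have := leq_mul (ltn_ord j) (leqnn r); rewrite ltnS mulSnr; lia.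
Qed.

(** The objective equation recovers window [0] from the coordinates; the digits are then unique in
    base [t]. *)
Lemma decode_inj n m (c : 'cV[{poly int}]_n) (A : 'M[{poly int}]_(m, n))
    (b : 'cV[{poly int}]_m) r s e e' :
  ip_digits c A b r s e -> ip_digits c A b r s e' -> e 0%N = e' 0%N ->
  decode n r e = decode n r e' -> forall i, (i < (n.+1 * r).+1)%N -> e i = e' i.
Proof.
move=> /ip_digitsP[de obj _] /ip_digitsP[de' obj' _] ee' dec [//|i].
rewrite ltnS => /window_index[a [k [lean ltkr ->]]].
have wE : window r a e = window r a e'.
  case: a lean => [_|a ltan]; first by rewrite obj obj' ee' dec.
  by have /colP/(_ (Ordinal ltan)) := dec; rewrite !mxE.
have := digit_dom_window lean de'; rewrite -ee' => bd'.
move: wE; rewrite /window -ee' => wE.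
exact: (base_val_inj (digit_dom_window lean de) bd' wE).
Qed.

Lemma decoded_ip_digits (R : realType) n m (c : 'cV[{poly int}]_n)
    (A : 'M[{poly int}]_(m, n)) (b : 'cV[{poly int}]_m) r s (t : int) : 0 < t ->
  (forall z, integer_points R A b t z -> (forall j, z j 0 < t ^+ r) /\
    0 <= ((eval_mx c t)^T *m z) 0 0 + t ^+ s < t ^+ r) ->
  decoded (ip_digits c A b r s) (decode n r) t = integer_points R A b t.
Proof.
move=> t_gt0 zb; apply/seteqP; split=> [x [e [<- /ip_digitsP[de _ rows] <-]]|z Lz].
  split=> [j|]; last by rewrite -map_mxM rows.
  rewrite !mxE ler0z; apply: base_val_ge0.
  exact: (digit_dom_window (ltn_ord j) de).
have [ztr objb] := zb z Lz.
have z_ge0 j : 0 <= z j 0 by have := Lz.1 j; rewrite mxE ler0z.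
pose X a := if a is j.+1 then ord_ext 0 (fun j => z j 0) j
  else ((eval_mx c t)^T *m z) 0 0 + t ^+ s.
have [|e [e0 de eX]] := @windows_exist n r t X t_gt0.
  case=> [|a] //=; apply: (@ord_ext_ind _ _ _ _ (fun x => 0 <= x < t ^+ r)).
    by rewrite lexx exprn_gt0.
  by move=> j; rewrite z_ge0 ztr.
have decE : decode n r e = z by apply/colP => j; rewrite mxE eX /= ord_extE.
exists e; split=> //; apply/ip_digitsP; split=> //.
  by rewrite eX decE e0.
rewrite decE e0; apply/colP => i; have := Lz.2; rewrite -map_mxM => /colP/(_ i).
by rewrite mxE [RHS]mxE => /intr_inj.
Qed.

(** The scalar product is at most [n * t^(2k)], hence at most [t^(2k+1)], in absolute value.
    Shifting by this power makes it nonnegative, as digits require, and at most [2 * t^(2k+1)],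
    which is below [t^(2k+3)]. *)
Lemma objective_bound n (c : 'cV[{poly int}]_n) (k : nat) (t : int) (z : 'cV[int]_n) :
  (n.+2)%:Z <= t -> (forall j, `|(c j 0).[t]| <= t ^+ k) ->
  (forall j, 0 <= z j 0 <= t ^+ k) ->
  0 <= ((eval_mx c t)^T *m z) 0 0 + t ^+ (k + k).+1 < t ^+ (k + k).+3.
Proof.
move=> nt cb zb; have t_ge0 : 0 <= t by lia.
have h : `|((eval_mx c t)^T *m z) 0 0| <= t ^+ (k + k).+1.
  rewrite mxE; apply: le_trans (ler_norm_sum _ _ _) _.
  apply: (@le_trans _ _ (\sum_(j < n) t ^+ (k + k))).
    apply: ler_sum => j _; rewrite !mxE normrM exprD; apply: ler_pM => //.
    by have /andP[z0 zt] := zb j; rewrite ger0_norm.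
  rewrite sumr_const card_ord -mulr_natl exprS ler_wpM2r ?exprn_ge0//; lia.
have tk : 0 < t ^+ (k + k).+1 by apply: exprn_gt0; lia.
rewrite (exprS t (k + k).+2) (exprS t (k + k).+1); move: h tk.
set a := t ^+ _; set v := (_ *m _) 0 0 => h tk.
have : 4 * a <= t * (t * a) by rewrite mulrA ler_pM2r//; nia.
by move: h; rewrite ler_norml; lia.
Qed.

Theorem theorem1p4 (R : realType) (n m : nat) (hn : (0 < n)%N) (hm : (0 < m)%N)
    (c : 'cV[{poly int}]_n) (A : 'M[{poly int}]_(m, n))
    (b : 'cV[{poly int}]_m)
    (hbounded : forall t : int, 0 < t -> bounded_set (real_points R A b t)) :
  forall l : nat, (0 < l)%N ->
    eventually_quasi_polynomial [set t : int | 0 < t] (lth_largest R c A b l).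
Proof.
move=> l _; have [K zK] := integer_points_bound hbounded.
have [Kc cK] := matrix_bound c.
(* [k] dominates the exponents for points and coefficients and the threshold [n.+2]; [s] and [r] are
   the shift exponent and digit count of [objective_bound]. *)
pose k := maxn n.+2 (maxn K Kc); pose s := (k + k).+1; pose r := (k + k).+3.
have leKk : (K <= k)%N by rewrite /k; lia.
have leKck : (Kc <= k)%N by rewrite /k; lia.
have k2 : (n.+2 <= k)%N by rewrite /k; lia.
have ptsE t : k%:Z <= t ->
    decoded (ip_digits c A b r s) (decode n r) t = integer_points R A b t.
  move=> lekt; apply: decoded_ip_digits => [|z Lz]; first by lia.
  have zb j := zK k leKk t z j lekt Lz.
  split; last by apply: objective_bound => //; [lia|move=> j; exact: cK].
  move=> j; have /andP[_ zt] := zb j; apply: le_lt_trans zt _.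
  by rewrite ltr_eXn2l; rewrite /r; lia.
have lerm : (r <= n.+1 * r)%N by rewrite leq_pmull.
have [e|e e'|e|Q [qQ bQ QP]] := @qf_nth_value R 'cV[int]_n (n.+1 * r) r (decode n r)
    (fun t z => ((eval_mx c t)^T *m z) 0 0) (fun t => t ^+ s) l.-1 (ip_digits c A b r s)
    (@decode_local n r) (qf_ip_digits c A b r s) _ lerm.
- by move=> /ip_digitsP[/andP[]].
- exact: decode_inj.
- move=> /ip_digitsP[_ obj _].
  by rewrite [X in _ = X - _](_ : _ = window r 0 e)// obj addrK.
have finL t : k%:Z <= t -> finite_set (decoded (ip_digits c A b r s) (decode n r) t).
  move=> lekt; rewrite ptsE//; apply: sub_finite_set (finite_int_box n (t ^+ k)) => z Lz j.
  exact: zK Lz.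
have gE t : k%:Z <= t -> lth_largest R c A b l t =
    nth_value R (decoded (ip_digits c A b r s) (decode n r) t)
      (fun z => ((eval_mx c t)^T *m z) 0 0) l.-1.
  by move=> lekt; rewrite ptsE.
apply: (@qf_eventually_quasi_polynomial R (n.+1 * r) r s Q k) => // [t e tk e0 Qe|t tk noQ].
  by rewrite gE//; apply: (QP t (finL t tk)).1.
by rewrite gE//; apply: (QP t (finL t tk)).2.
Qed.
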